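(* Let $P=\{P_n(x)\}_{n=0}^{\infty}$ be a sequence of orthogonal polynomials on an interval $\mathcal{I}=(l,r)\subseteq\mathbb{R}$ of the real line. Let $M(x)=\frac{ax+b}{cx+d}$ with $a,b,c,d\in\mathbb{C}$, $ad-bc\ne0$, let $W(x)=-\frac{dx-b}{cx-a}$ be its inverse, and suppose that $P_n(a/c)\ne0$ for all $n$. Then, for every $n\ge1$, all the zeros of the Möbius-transformed polynomial $Q_n(x)=(cx+d)^nP_n(M(x))$ lie on the curve $\Gamma=\{W(x):l<x<r\}$, and these zeros are all simple.
   Context: A sequence of orthogonal polynomials on $(l,r)$ is a sequence of real polynomials $P_n$ with $\deg P_n=n$ such that $\int_l^rP_mP_nw\,dx=K_m\delta_{m,n}$, $K_m>0$, for some continuous non-negative weight function $w$ on $(l,r)$ (the interval may be finite, semi-infinite or infinite). $M$ and $W$ are mutually inverse bijections of $\mathbb{C}_\infty=\mathbb{C}\cup\{\infty\}$, with $W(a/c)=\infty$. When $c=0$ the point $a/c$ is $\infty$ and the condition $P_n(a/c)\neq 0$ is vacuous. *)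

(* Defs.v *)
From HB Require Import structures.
From mathcomp Require Import all_boot all_order all_algebra.
From mathcomp Require Import all_classical all_reals all_analysis.
From mathcomp Require Import complex.
From mathcomp Require Import ring.

Set Implicit Arguments.
Unset Strict Implicit.
Unset Printing Implicit Defensive.

Import Order.TTheory GRing.Theory Num.Theory.
Import numFieldNormedType.Exports.

Local Open Scope classical_set_scope.
Local Open Scope ring_scope.

(* The endpoints are extended reals, so that finite, semi-infinite and infinite
   intervals are all covered. *)
Definition open_interval (R : realType) (l r : \bar R) : set R :=
  [set x : R | (l < x%:E)%E /\ (x%:E < r)%E].

(* Integrability is stated explicitly because the Lebesgue integral of a
   non-integrable function still has a (conventional) value. *)
Definition orthogonal_polynomials (R : realType) (l r : \bar R)
    (P : nat -> {poly R}) : Prop :=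
  [/\ (l < r)%E,
      forall n, size (P n) = n.+1 &
      exists w : R -> R, exists K : nat -> R,
      [/\ {within open_interval l r, continuous w},
          forall x, open_interval l r x -> 0 <= w x,
          forall m, 0 < K m &
          forall m n,
            (@lebesgue_measure R).-integrable (open_interval l r)
              (fun x => ((P m).[x] * (P n).[x] * w x)%:E) /\
            (\int[@lebesgue_measure R]_(x in open_interval l r)
               ((P m).[x] * (P n).[x] * w x)%:E
             = (K m * (m == n)%:R)%:E)%E]].

Definition complexify (R : realType) (p : {poly R}) : {poly R[i]} :=
  map_poly (real_complex R) p.

(* [option R[i]] is the Riemann sphere, with [None] the point at infinity. *)
Definition mobius (R : realType) (a b c d : R[i]) (z : option R[i]) :
    option R[i] :=
  match z with
  | Some x => if c * x + d == 0 then None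
              else Some ((a * x + b) / (c * x + d))
  | None => if c == 0 then None else Some (a / c)
  end.

(* x |-> - (d x - b) / (c x - a) *)
Definition mobius_inv (R : realType) (a b c d : R[i]) :
    option R[i] -> option R[i] :=
  mobius (- d) b c (- a).

Lemma mobiusK (R : realType) (a b c d : R[i]) :
  a * d - b * c != 0 -> cancel (mobius a b c d) (mobius_inv a b c d).
Proof.
move=> D0 [x|] /=; rewrite /mobius_inv /=.
- case: (eqVneq (c * x + d) 0) => [E|N] /=.
    have c0 : c != 0.
      apply: contra_neq D0 => c0.
      by move: E; rewrite c0 mul0r add0r => ->; rewrite !mulr0 subrr.
    rewrite (negbTE c0); congr Some.
    by apply: (mulfI c0); rewrite mulrC divfK //; apply/eqP;
      rewrite eq_sym -addr_eq0 E.
  have E : c * ((a * x + b) / (c * x + d)) - a = - (a * d - b * c) / (c * x + d).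
    by field.
  rewrite E mulf_eq0 invr_eq0 oppr_eq0 (negbTE D0) (negbTE N) /=; congr Some.
  have -> : - d * ((a * x + b) / (c * x + d)) + b =
            x * (- (a * d - b * c) / (c * x + d)) by field.
  by rewrite mulfK // mulf_neq0 ?invr_eq0 ?oppr_eq0.
- case: (eqVneq c 0) => [c0|c0] /=; first by rewrite c0 eqxx.
  by rewrite mulrC divfK // subrr eqxx.
Qed.

Lemma mobius_invK (R : realType) (a b c d : R[i]) :
  a * d - b * c != 0 -> cancel (mobius_inv a b c d) (mobius a b c d).
Proof.
move=> D0; have -> : mobius a b c d = mobius_inv (- d) b c (- a).
  by rewrite /mobius_inv !opprK.
by apply: mobiusK; rewrite mulrNN mulrC.
Qed.

(* (c x + d)^n p((a x + b) / (c x + d)) with denominators cleared, for p of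
   degree at most n; see [horner_mobius_poly]. *)
Definition mobius_poly (R : realType) (a b c d : R[i]) (n : nat)
    (p : {poly R}) : {poly R[i]} :=
  \sum_(k < n.+1)
    (complexify p)`_k *: ((a *: 'X + b%:P) ^+ k * (c *: 'X + d%:P) ^+ (n - k)).

Lemma horner_mobius_poly (R : realType) (a b c d : R[i]) (n : nat)
    (p : {poly R}) (x y : R[i]) :
  (size p <= n.+1)%N -> mobius a b c d (Some x) = Some y ->
  (mobius_poly a b c d n p).[x] = (c * x + d) ^+ n * (complexify p).[y].
Proof.
move=> sp /=; case: eqP => // /eqP D0 [<-].
have sp' : (size (complexify p) <= n.+1)%N.
  by rewrite size_map_poly.
rewrite (horner_coef_wide _ sp').
rewrite /mobius_poly horner_sum mulr_sumr; apply: eq_bigr => k _.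
rewrite hornerZ hornerM !horner_exp !hornerD !hornerZ hornerX !hornerC.
rewrite [RHS]mulrCA; congr (_ * _).
rewrite exprMn exprVn -[X in _ = _ ^+ X * _](subnK (leq_ord k)) exprD.
by field; rewrite expf_neq0.
Qed.

Definition mobius_curve (R : realType) (a b c d : R[i]) (l r : \bar R) :
    set (option R[i]) :=
  [set mobius_inv a b c d (Some (real_complex R x)) | x in open_interval l r].

(* Main.v *)
Require Import Defs.
From HB Require Import structures.
From mathcomp Require Import all_boot all_order all_algebra.
From mathcomp Require Import all_classical all_reals all_analysis.
From mathcomp Require Import complex.
From mathcomp Require Import ring.

Set Implicit Arguments.
Unset Strict Implicit.
Unset Printing Implicit Defensive.

Import Order.TTheory GRing.Theory Num.Theory.
Import numFieldNormedType.Exports.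

Local Open Scope classical_set_scope.
Local Open Scope ring_scope.

(** Let [L p] be the integral of [p w]. Expanding in the basis [P] shows that
    [L (q^2) > 0] for [q != 0] and that [P n] is orthogonal to all [q] of degree
    less than [n]. If [P n] had a conjugate pair of non-real roots or a double
    real root, it would be [((X - x)^2 + y^2) q] with [x], [y] real; if it had
    a real root [x] outside [(l, r)], it would be [(X - x) q] with [X - x] of
    constant sign on the interval. In both cases [L (P n q) = 0] contradicts
    positivity. Hence [P n] splits into distinct factors [X - x_i] with [x_i] in
    [(l, r)], and homogenizing sends [X - x_i] to
    [(a - x_i c) X + (b - x_i d)], a linear factor because [x_i <> a / c],
    whose root is [W(x_i)]; injectivity of [W] gives simplicity. *)

(** * Graded bases and positive functionals *)

Lemma poly_graded_basis (F : fieldType) (P : nat -> {poly F}) :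
  (forall n, size (P n) = n.+1) -> forall n (p : {poly F}),
  (size p <= n)%N -> exists c : nat -> F, p = \sum_(i < n) c i *: P i.
Proof.
move=> sP; elim=> [|n IH] p sp.
  by exists (fun=> 0); rewrite big_ord0; apply/eqP; rewrite -size_poly_leq0.
(* Chosen so that [p - t *: P n] has no coefficient in degree [n]. *)
pose t := p`_n / (P n)`_n.
have Pn0 : (P n)`_n != 0.
  by have := lead_coef_eq0 (P n); rewrite lead_coefE sP -size_poly_eq0 sP => ->.
have [|c Ec] := IH (p - t *: P n).
  apply/leq_sizeP => j; rewrite leq_eqVlt coefB coefZ => /predU1P[<-|nj].
    by rewrite divfK ?subrr.
  by rewrite !nth_default ?mulr0 ?subrr ?sP ?(leq_trans sp).
exists (fun i => if (i < n)%N then c i else t).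
rewrite big_ord_recr /= ltnn -(subrK (t *: P n) p) Ec; congr (_ + _).
by apply: eq_bigr => i _; rewrite ltn_ord.
Qed.

Section PositiveFunctional.
Context (F : realFieldType) (L : {linear {poly F} -> F^o}).
Context (P : nat -> {poly F}) (K : nat -> F).
Hypothesis sP : forall n, size (P n) = n.+1.
Hypothesis K_gt0 : forall n, 0 < K n.
Hypothesis LP : forall m n, L (P m * P n) = K m * (m == n)%:R.

Lemma functional_orthogonal n (q : {poly F}) : (size q <= n)%N -> L (P n * q) = 0.
Proof.
move=> /(poly_graded_basis sP)[c ->].
rewrite mulr_sumr linear_sum big1 // => i _.
by rewrite -scalerAr linearZ /= LP gtn_eqF ?mulr0 ?scaler0.
Qed.

(** Once [q] is expanded along [P], orthogonality kills the cross terms and leaves a sum of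
    [c i ^+ 2 * K i], which vanishes only if every [c i] does. *)
Lemma functional_sqr_gt0 (q : {poly F}) : q != 0 -> 0 < L (q * q).
Proof.
have [c] := poly_graded_basis sP (leqnn (size q)).
move: (size q) => N Eq; have -> : L (q * q) = \sum_(i < N) c i ^+ 2 * K i.
  rewrite {1}Eq mulr_suml linear_sum; apply: eq_bigr => i _.
  rewrite -scalerAl linearZ [in L _]Eq mulr_sumr linear_sum (bigD1 i) //=.
  rewrite big1 ?addr0 => [|j ji]; rewrite -scalerAr linearZ /= LP.
    by rewrite eqxx mulr1 /GRing.scale /= mulrA.
  by rewrite val_eqE eq_sym (negbTE ji) mulr0 scaler0.
have ge0 (i : 'I_N) : true -> 0 <= c i ^+ 2 * K i.
  by move=> _; rewrite mulr_ge0 ?sqr_ge0 // ltW.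
move=> q0; rewrite lt0r sumr_ge0 // andbT; apply: contra_neq q0 => /eqP.
rewrite psumr_eq0 // => /allP c0; rewrite Eq big1 // => i _.
have := c0 i (mem_index_enum i); rewrite /= mulf_eq0 sqrf_eq0 (gt_eqF (K_gt0 i)) orbF.
by move=> /eqP->; rewrite scale0r.
Qed.

(* If [P n = ((X - x)^2 + y^2) q], pairing [P n] with [q] would give
   [0 = L (((X - x) q)^2) + y^2 L (q^2) > 0]. *)
Lemma quadratic_ndvd n x y :
  ~~ (('X - x%:P) * ('X - x%:P) + (y * y)%:P %| P n).
Proof.
set d := (X in X %| _).
apply/negP => /dvdpP[q Eq].
have Pn0 : P n != 0 by rewrite -size_poly_eq0 sP.
have q0 : q != 0 by apply: contra_neq Pn0 => q0; rewrite Eq q0 mul0r.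
have sd : size d = 3%N.
  rewrite /d size_polyDl size_mul ?polyXsubC_eq0 // !size_XsubC //.
  by rewrite (leq_ltn_trans (size_polyC_leq1 _)).
have sq : (size q <= n)%N.
  have := sP n; rewrite Eq size_mul // -?size_poly_eq0 ?sd //.
  by rewrite addn3 /= => -[<-].
have := functional_orthogonal sq.
have -> : P n * q =
    (('X - x%:P) * q) * (('X - x%:P) * q) + (y * y) *: (q * q).
  by rewrite Eq /d -mul_polyC; ring.
rewrite linearD linearZ /= => /eqP; rewrite gt_eqF // ltr_pwDl //.
  by rewrite functional_sqr_gt0 // mulf_neq0 ?polyXsubC_eq0.
by rewrite mulr_ge0 -?expr2 ?sqr_ge0 // ltW // functional_sqr_gt0.
Qed.

End PositiveFunctional.

(** * Real and simple roots *)

(** Identifies a conjugate pair of factors with a real quadratic, so that divisibility over [R[i]]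
    descends to [R]. *)
Lemma conj_XsubC_mul (R : realType) (z : R[i]) :
  ('X - z%:P) * ('X - (conjc z)%:P) =
  complexify (('X - (complex.Re z)%:P) * ('X - (complex.Re z)%:P) + (complex.Im z * complex.Im z)%:P).
Proof.
have zE : z = real_complex R (complex.Re z) + 'i%C * real_complex R (complex.Im z).
  by rewrite [LHS]complexE.
have zJE : conjc z = real_complex R (complex.Re z) - 'i%C * real_complex R (complex.Im z).
  by rewrite {1}zE rmorphD rmorphM /= oppr0; simpc.
have i2 : ('i%C)%:P * ('i%C)%:P = -1 :> {poly R[i]}.
  by rewrite -polyCM -expr2 sqr_i polyCN.
rewrite /complexify rmorphD rmorphM /= rmorphB /= map_polyX !map_polyC /=.
rewrite rmorphM polyCM zJE [X in ('X - X%:P) * _]zE polyCB polyCD polyCM.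
set x := (real_complex R (complex.Re z))%:P; set y := (real_complex R (complex.Im z))%:P.
transitivity (('X - x) * ('X - x) - ('i%C)%:P * ('i%C)%:P * (y * y)); first ring.
by rewrite i2 mulN1r opprK.
Qed.

(** The excluded quadratics cover both defects: a conjugate pair of roots for [y != 0], a double
    real root for [y = 0]. *)
Lemma real_simple_roots (R : realType) (p : {poly R}) (s : seq R[i])
    (k : R[i]) : complexify p = k *: \prod_(z <- s) ('X - z%:P) ->
  (forall x y, ~~ (('X - x%:P) * ('X - x%:P) + (y * y)%:P %| p)) ->
  exists2 t : seq R, s = map (real_complex R) t & uniq t.
Proof.
move=> Ep ndvd.
have E (z : R[i]) : ~~ (('X - z%:P) * ('X - (conjc z)%:P) %| complexify p).
  by rewrite conj_XsubC_mul dvdp_map.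
have p0 : complexify p != 0.
  by apply: contraNneq (E 0) => ->; rewrite dvdp0.
have k0 : k != 0 by apply: contra_neq p0 => k0; rewrite Ep k0 scale0r.
have real z : z \in s -> z = real_complex R (complex.Re z).
  move=> zs; have rz : root (complexify p) z by rewrite Ep rootZ ?root_prod_XsubC.
  apply: contraNeq (E z) => zr.
  (* Conjugation fixes the coefficients of [complexify p]. *)
  have rz' : root (complexify p) (conjc z).
    rewrite -complex_root_conj /complexify -map_poly_comp.
    rewrite (eq_map_poly (g := real_complex R)) // => x /=.
    by rewrite oppr0.
  have := @uniq_roots_dvdp _ (complexify p) [:: z; conjc z].
  rewrite big_cons big_seq1; apply; rewrite /= ?rz ?rz' //.
  rewrite /diff_roots mulrC eqxx /= unitfE andbT subr_eq0.
  rewrite andbT; apply: contra_neq zr; case: z {zs rz rz'} => x y [] /eqP.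
  by rewrite -subr_eq0 -opprD oppr_eq0 -mulr2n mulrn_eq0 /= => /eqP->.
exists (map (@complex.Re R) s).
  by rewrite -map_comp map_id_in // => z /real.
apply: (@map_uniq _ _ (real_complex R)).
rewrite -map_comp map_id_in => [|z /real //].
(* A repeated [z] would make the square of ['X - z%:P] divide [complexify p]; as [z] is real, this
   is the product that [E z] forbids. *)
apply: count_mem_uniq => z; case: (boolP (z \in s)) => [zs|/count_memPn //].
apply/eqP; rewrite eqn_leq -has_count has_pred1 zs andbT.
rewrite -mu_prod_XsubC -(mupMr _ (_ : ~~ root k%:P z)) ?rootC //.
rewrite mul_polyC -Ep mup_leq //; apply: contra (E z).
by rewrite [in conjc _](real _ zs) conjc_real -(real _ zs) expr2.
Qed.

(** * Homogenization of split polynomials *)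

(** By induction on [s]: in a new factor ['X - x%:P], the shift by ['X] yields [u], and the constant
    [x] yields [v] because the total degree grows by one. *)
Lemma homogenize_prod_XsubC (C : comNzRingType) (u v : {poly C}) (s : seq C) :
  \sum_(k < (size s).+1)
     (\prod_(x <- s) ('X - x%:P))`_k *: (u ^+ k * v ^+ (size s - k)) =
  \prod_(x <- s) (u - x *: v).
Proof.
elim: s => [|x s IH].
  by rewrite !big_nil big_ord1 coef1 scale1r mulr1.
rewrite !big_cons -IH /=; set p := \prod_(_ <- s) _.
have sp : size p = (size s).+1 by rewrite /p size_prod_XsubC.
under eq_bigr => k _ do rewrite mulrBl mul_polyC coefB scalerBl.
rewrite sumrB mulrBl; congr (_ - _).
  rewrite big_ord_recl coefXM eqxx scale0r add0r mulr_sumr.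
  by apply: eq_bigr => k _; rewrite coefXM /= subSS exprS -mulrA scalerAr.
(* The top coefficient lies beyond the degree of [p]; each remaining term has a spare factor [v]. *)
rewrite big_ord_recr /= coefZ [p`_(size s).+1]nth_default ?sp //.
rewrite mulr0 scale0r addr0 mulr_sumr; apply: eq_bigr => k _.
rewrite coefZ subSn ?leq_ord // exprS -scalerA -scalerAl; congr (_ *: _).
by rewrite -scalerAr mulrCA.
Qed.

Lemma mobius_poly_prod (R : realType) (a b c d k : R[i]) (p : {poly R})
    (s : seq R[i]) : complexify p = k *: \prod_(x <- s) ('X - x%:P) ->
  mobius_poly a b c d (size s) p =
  k *: \prod_(x <- s) ((a - x * c) *: 'X + (b - x * d)%:P).
Proof.
move=> Ep; rewrite /mobius_poly Ep.
transitivity (k *: \prod_(x <- s)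
    ((a *: 'X + b%:P) - x *: (c *: 'X + d%:P) : {poly R[i]})).
  rewrite -homogenize_prod_XsubC scaler_sumr; apply: eq_bigr => i _.
  by rewrite coefZ scalerA.
congr (_ *: _); apply: eq_bigr => x _.
by rewrite -!mul_polyC polyCB polyCM polyCB polyCM; ring.
Qed.

(** * Integration against the weight *)

(** An integrand of constant sign with zero integral vanishes almost everywhere; [x - x0] is nonzero
    on [D], so [q^2 w] vanishes there too. *)
Lemma integral_XsubC_sqr_eq0 (R : realType) (D : set R) (w : R -> R) (x0 : R)
    (q : {poly R}) :
  measurable D -> (forall x, D x -> 0 <= w x) ->
  (forall p : {poly R},
     (@lebesgue_measure R).-integrable D (fun x => (p.[x] * w x)%:E)) ->
  (forall x, D x -> x0 < x) \/ (forall x, D x -> x < x0) ->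
  (\int[@lebesgue_measure R]_(x in D)
     ((('X - x0%:P) * (q * q)).[x] * w x)%:E = 0)%E ->
  (\int[@lebesgue_measure R]_(x in D) ((q * q).[x] * w x)%:E = 0)%E.
Proof.
move=> mD w0 iw sgn I0.
(* [e] is the sign of [x - x0] on [D]. *)
have [e eD] : exists e : R, forall x, D x -> 0 < e * (x - x0).
  case: sgn => sgn.
    by exists 1 => x /sgn; rewrite mul1r subr_gt0.
  by exists (-1) => x /sgn; rewrite mulN1r opprB subr_gt0.
pose f x := ((e *: (('X - x0%:P) * (q * q))).[x] * w x)%:E.
have fE x : f x = (e * (x - x0) * ((q.[x] * q.[x]) * w x))%:E.
  by rewrite /f hornerZ !hornerM hornerXsubC; congr EFin; ring.
have f0 : (\int[@lebesgue_measure R]_(x in D) `|f x| = 0)%E.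
  transitivity (\int[@lebesgue_measure R]_(x in D)
     (e%:E * ((('X - x0%:P) * (q * q)).[x] * w x)%:E))%E.
    apply: eq_integral => x /set_mem Dx; rewrite gee0_abs.
      by rewrite /f hornerZ -EFinM -mulrA.
    rewrite fE lee_fin mulr_ge0 ?(ltW (eD _ Dx)) // mulr_ge0 ?w0 //.
    by rewrite -expr2 sqr_ge0.
  by rewrite integralZl // I0 mule0.
have /integrableP[mf _] := iw (e *: (('X - x0%:P) * (q * q))).
have ae0 := (ae_eq_integral_abs (@lebesgue_measure R) mD mf).1 f0.
rewrite (ae_eq_integral (cst 0%E)) ?integral0 //.
  by have /integrableP[] := iw (q * q).
apply: filterS ae0 => x /= + Dx => /(_ Dx); rewrite -/(f x) fE => -[/eqP].
rewrite mulf_eq0 gt_eqF ?eD //= => /eqP.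
by rewrite hornerM => ->.
Qed.

(** Hides the integral behind an abstract functional; the last clause retains what locating the
    roots requires of the interval. *)
Lemma orthogonal_polynomials_functional (R : realType) (l r : \bar R)
    (P : nat -> {poly R}) : orthogonal_polynomials l r P ->
  exists (L : {linear {poly R} -> R^o}) (K : nat -> R),
  [/\ forall n, 0 < K n,
      forall m n, L (P m * P n) = K m * (m == n)%:R &
      forall (x0 : R) (q : {poly R}), ~ open_interval l r x0 ->
        L (('X - x0%:P) * (q * q)) = 0 -> L (q * q) = 0].
Proof.
case=> lr sP [w [K [cw w0 K0 H]]].
set D := open_interval l r in cw w0 H *.
set mu := @lebesgue_measure R in H *.
have mD : measurable (D : set (measurableTypeR R)).
  have -> : D = (setT `&` [set x : R | (l < x%:E)%E]) `&`
                (setT `&` [set x : R | (x%:E < r)%E]) by rewrite !setTI.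
  by apply: measurableI; apply: measurable_lte.
have iw p : mu.-integrable D (fun x => (p.[x] * w x)%:E).
  have [c ->] := poly_graded_basis sP (leqnn (size p)).
  (* Integrability is given for products [P m * P n] only; [P 0] is a nonzero constant [k], so
     dividing by [k] gives it for each [P i]. *)
  have /size_poly1P[k k0 P0] : size (P 0%N) == 1%N by rewrite sP.
  have := integrable_sum mD (index_enum 'I_(size p)) (P := xpredT)
    (fun i _ => integrableZl mD (c i / k) (H 0%N i).1).
  apply: eq_integrable => // x _.
  rewrite horner_sum mulr_suml sumEFin; congr EFin.
  by apply: eq_bigr => i _; rewrite hornerZ P0 hornerC /=; field.
pose L (p : {poly R}) : R^o := Rintegral mu D (fun x => p.[x] * w x).
have LE p : (\int[mu]_(x in D) (p.[x] * w x)%:E)%E = (L p)%:E.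
  by rewrite /L /Rintegral fineK // integrable_fin_num.
have L_lin : linear L.
  move=> k p q; rewrite /L /=.
  transitivity (Rintegral mu D (fun x => k * (p.[x] * w x) + q.[x] * w x)).
    by apply: eq_Rintegral => x _; rewrite hornerD hornerZ mulrDl mulrA.
  rewrite RintegralD // ?RintegralZl //; [exact: iw| |exact: iw].
  apply: eq_integrable (iw (k *: p)) => // x _ /=.
  by rewrite hornerZ mulrA.
pose LL : {linear {poly R} -> R^o} :=
  HB.pack L (GRing.isLinear.Build R {poly R} R^o *:%R L L_lin).
exists LL, K; split=> // [m n|x0 q nx0 I0].
  apply: EFin_inj; rewrite -LE -(H m n).2; apply: eq_integral => x _.
  by rewrite hornerM.
apply: EFin_inj; rewrite -LE; apply: (integral_XsubC_sqr_eq0 (x0 := x0)) => //.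
  have [lx|xl] := ltP l x0%:E.
    have [xr|rx] := ltP x0%:E r; first by case: nx0.
    by right=> x [_ xr]; rewrite -lte_fin (lt_le_trans xr).
  by left=> x [lx _]; rewrite -lte_fin (le_lt_trans xl).
by rewrite LE; congr EFin.
Qed.

(** * Zeros of [P n] and of its transform *)

Lemma orthogonal_polynomials_roots (R : realType) (l r : \bar R)
    (P : nat -> {poly R}) (n : nat) : orthogonal_polynomials l r P ->
  exists t : seq R,
  [/\ size t = n, uniq t, {in t, forall x, open_interval l r x} &
      complexify (P n) = lead_coef (complexify (P n)) *:
        \prod_(x <- map (real_complex R) t) ('X - x%:P)].
Proof.
move=> hP; have [L [K [K0 LP Lout]]] := orthogonal_polynomials_functional hP.
case: hP => _ sP _.
have [s Es] := closed_field_poly_normal (complexify (P n)).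
have [t st ut] := real_simple_roots Es (quadratic_ndvd sP K0 LP n).
subst s; exists t; split=> //.
  have := congr1 (fun p : {poly _} => size p) Es.
  rewrite /complexify size_map_poly sP size_scale ?size_prod_XsubC ?size_map.
    by case.
  by rewrite lead_coef_eq0 -size_poly_eq0 size_map_poly sP.
move=> x xt; apply: contrapT => nx.
have : root (P n) x.
  rewrite -(fmorph_root (real_complex R)) -/(complexify _) Es rootZ.
    by rewrite root_prod_XsubC map_f.
  by rewrite lead_coef_eq0 -size_poly_eq0 size_map_poly sP.
rewrite -dvdp_XsubCl => /dvdpP[q Eq].
have q0 : q != 0.
  by apply: contra_eq_neq (sP n) => q0; rewrite Eq q0 mul0r size_poly0.
have sq : (size q <= n)%N.
  by have := sP n; rewrite Eq size_mul ?polyXsubC_eq0 // size_XsubC addn2 => -[<-].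
(* Here [('X - x%:P) * (q * q)] is [P n * q], on which [L] vanishes by degree. *)
have := functional_sqr_gt0 sP K0 LP q0; rewrite (Lout x) ?ltxx //.
by rewrite mulrCA mulrA -Eq (functional_orthogonal sP LP).
Qed.

Theorem theorem6 (R : realType) (l r : \bar R) (P : nat -> {poly R})
    (a b c d : R[i])
    (hP : orthogonal_polynomials l r P)
    (hdet : a * d - b * c != 0)
    (hac : c != 0 -> forall n : nat, (complexify (P n)).[a / c] != 0) :
  forall n : nat, (1 <= n)%N ->
  forall z : R[i], root (mobius_poly a b c d n (P n)) z ->
    mobius_curve a b c d l r (Some z) /\
    mup z (mobius_poly a b c d n (P n)) = 1%N.
Proof.
move=> n _ z.
have [t [st ut tI Et]] := orthogonal_polynomials_roots n hP.
set k := lead_coef _ in Et.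
have k0 : k != 0.
  by case: hP => _ sP _; rewrite lead_coef_eq0 -size_poly_eq0 size_map_poly sP.
(* The root of the linear factor [(a - x c) X + (b - x d)]. *)
pose W x := - (b - real_complex R x * d) / (a - real_complex R x * c).
(* For [c = 0] the determinant forces [a != 0]; otherwise [x = a / c] would be a root of [P n]. *)
have Wden x : x \in t -> a - real_complex R x * c != 0.
  move=> xt; rewrite subr_eq0; have [c0|c0] := eqVneq c 0.
    by apply: contra_neq hdet => ->; rewrite c0 !mulr0 mul0r subrr.
  apply: contra (hac c0 n) => /eqP->; rewrite mulfK // -/(root _ _) Et rootZ //.
  by rewrite root_prod_XsubC map_f.
have W_inv x : x \in t ->
    mobius_inv a b c d (Some (real_complex R x)) = Some (W x).
  move=> /Wden den; have den' : c * real_complex R x - a != 0.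
    by rewrite mulrC -opprB oppr_eq0.
  rewrite /mobius_inv /= (negbTE den'); congr Some; rewrite /W.
  by field; rewrite den.
have uW : uniq (map W t).
  rewrite map_inj_in_uniq // => x y xt yt Exy.
  have := congr1 Some Exy; rewrite -!W_inv // => /(can_inj (mobius_invK hdet)).
  by case.
have [k' k'0 ->] : exists2 k', k' != 0 &
    mobius_poly a b c d n (P n) = k' *: \prod_(x <- map W t) ('X - x%:P).
  rewrite -[n in mobius_poly _ _ _ _ n]st -(size_map (real_complex R)).
  rewrite (mobius_poly_prod _ _ _ _ Et) !big_map.
  (* The leading coefficients of the linear factors are pulled out to make them monic. *)
  exists (k * \prod_(x <- t) (a - real_complex R x * c)).
    rewrite mulf_neq0 // prodf_seq_neq0; apply/allP => x /Wden.
    exact.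
  rewrite -scalerA -scaler_prod; congr (_ *: _).
  rewrite !big_seq; apply: eq_bigr => x /Wden den.
  rewrite scalerBr; congr (_ + _).
  by rewrite -mul_polyC -polyCM -polyCN /W; congr polyC; field.
rewrite rootZ // root_prod_XsubC => zW; split.
  have /mapP[x xt ->] := zW.
  by exists x; [exact: tI|rewrite W_inv].
rewrite -mul_polyC mupMr ?rootC // mu_prod_XsubC.
by rewrite count_uniq_mem // zW.
Qed.
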